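(* Let $\Gamma$ be a non-self-dual pointclass which contains the closed sets. Then there is a set $W \subseteq \{1,2\}^\omega$ such that $\mathsf{HC}^*(W) = \bigcap_{w \in W} \mathsf{HC}(w)$ is not in $\Gamma$.
   Context: $\omega=\{0,1,2,\dots\}$ and $\ell^2$ is the Hilbert space of square-summable real sequences indexed by $\omega$ with its norm topology. For a bounded sequence $w \in \ell^\infty$ (in particular for $w\in\{1,2\}^\omega$), the weighted backward shift $B_w:\ell^2\to\ell^2$ is $B_w(x)(i) = w(i)\,x(i+1)$ for $i\in\omega$. A vector $x\in\ell^2$ is hypercyclic for $B_w$ if $\{B_w^k(x): k\in\omega\}$ is dense in $\ell^2$; $\mathsf{HC}(w)$ denotes the set of such $x$, and for $W\subseteq \ell^\infty$, $\mathsf{HC}^*(W)=\bigcap_{w\in W}\mathsf{HC}(w)$. A pointclass is a collection $\Gamma$ of subsets of Polish spaces closed under continuous preimages, finite unions and finite intersections. Its dual $\bar\Gamma$ consists of those $Y\subseteq X$ ($X$ Polish) with $X\setminus Y\in\Gamma$. $\Gamma$ is non-self-dual if there is a Polish space $X$ and $Y\subseteq X$ with $Y\in\Gamma$ but $Y\notin\bar\Gamma$. *)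

(* Defs.v *)
From HB Require Import structures.
From mathcomp Require Import all_boot all_order all_algebra.
From mathcomp Require Import all_classical all_reals all_analysis.
From mathcomp Require Import Rstruct Rstruct_topology.
Set Implicit Arguments. Unset Strict Implicit. Unset Printing Implicit Defensive.
Import Order.TTheory GRing.Theory Num.Theory.
Import numFieldNormedType.Exports.
Local Open Scope classical_set_scope.
Local Open Scope ring_scope.

Notation RR := Rdefinitions.R.

Definition polish (T : topologicalType) : Prop :=
  (exists D : set T, countable D /\ closure D = setT) /\
  exists d : T -> T -> RR,
    [/\ (forall x y, 0 <= d x y) /\ (forall x y, d x y = 0 <-> x = y),
        (forall x y, d x y = d y x),
        (forall x y z, d x z <= d x y + d y z),
        (forall A : set T, open A <->
           (forall x, A x -> exists2 e : RR, 0 < e & [set y | d x y < e] `<=` A)) &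
        (forall u : nat -> T,
           (forall e : RR, 0 < e -> exists N, forall m n,
               (N <= m)%N -> (N <= n)%N -> d (u m) (u n) < e) ->
           exists l : T, u @ \oo --> l)].

Definition pointclass (Gamma : forall T : topologicalType, set (set T)) : Prop :=
  [/\ (forall (X Y : topologicalType) (f : X -> Y), polish X -> polish Y ->
         continuous f -> forall B : set Y, Gamma Y B -> Gamma X (f @^-1` B)),
      (forall X : topologicalType, polish X ->
         forall A B : set X, Gamma X A -> Gamma X B -> Gamma X (A `|` B)) &
      (forall X : topologicalType, polish X ->
         forall A B : set X, Gamma X A -> Gamma X B -> Gamma X (A `&` B))].

Definition dual_pointclass (Gamma : forall T : topologicalType, set (set T))
  : forall T : topologicalType, set (set T) :=
  fun T => [set Y : set T | Gamma T (~` Y)].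

Definition non_self_dual (Gamma : forall T : topologicalType, set (set T)) : Prop :=
  exists (X : topologicalType) (Y : set X),
    polish X /\ Gamma X Y /\ ~ @dual_pointclass Gamma X Y.

Definition contains_closed (Gamma : forall T : topologicalType, set (set T)) : Prop :=
  forall (X : topologicalType), polish X -> forall A : set X, closed A -> Gamma X A.

Definition sqsum (x : nat -> RR) : \bar RR :=
  (\sum_(0 <= i <oo) ((x i) ^+ 2)%:E)%E.

Definition square_summable (x : nat -> RR) : Prop := (sqsum x < +oo)%E.

Record l2 : Type := L2 { l2val : nat -> RR ; l2P : square_summable l2val }.

Definition l2norm (x : nat -> RR) : RR := Num.sqrt (fine (sqsum x)).


HB.instance Definition _ := gen_eqMixin l2.
HB.instance Definition _ := gen_choiceMixin l2.

Definition l2_open : set_system l2 :=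
  [set A | forall x, A x -> exists2 e : RR, 0 < e &
     forall y : l2, l2norm (fun i => l2val y i - l2val x i) < e -> A y].

Lemma l2_openT : l2_open setT.
Proof. by move=> x _; exists 1 => //. Qed.

Lemma l2_openI : setI_closed l2_open.
Proof.
move=> A B oA oB x [Ax Bx].
have [e1 e1p h1] := oA x Ax; have [e2 e2p h2] := oB x Bx.
exists (Num.min e1 e2); first by rewrite lt_min e1p e2p.
move=> y; rewrite lt_min => /andP[y1 y2]; split; [exact: h1|exact: h2].
Qed.

Lemma l2_open_bigU (I : Type) (f : I -> set l2) :
  (forall i, l2_open (f i)) -> l2_open (\bigcup_i f i).
Proof.
move=> hf x [i _ fx]; have [e ep h] := hf i x fx.
by exists e => // y /h fy; exists i.
Qed.

HB.instance Definition _ :=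
  isOpenTopological.Build l2 l2_openT l2_openI l2_open_bigU.

(** Weighted backward shift B_w x (i) = w(i) x(i+1), on raw sequences and on l^2.
    For bounded w (in particular w in {1,2}^omega) B_w maps l^2 to l^2, so the
    fallback branch below is never used for the weights considered. *)
Definition bshift (w x : nat -> RR) : nat -> RR := fun i => w i * x i.+1.

Definition B (w : nat -> RR) (x : l2) : l2 :=
  match pselect (square_summable (bshift w (l2val x))) with
  | left H => L2 H
  | right _ => x
  end.

Definition HC (w : nat -> RR) : set l2 :=
  [set x | dense (range (fun k : nat => iter k (B w) x))].

Definition HCstar (W : set (nat -> RR)) : set l2 := \bigcap_(w in W) HC w.

Definition one_two : set (nat -> RR) := [set w | forall i, w i = 1 \/ w i = 2].

(* Main.v *)
(* Let [Y] be in [Gamma X] with [~` Y] not in [Gamma X], and let [d] be a metric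
   of [X].  There are a Lipschitz map [phi : X -> l2] and weights [w y] such that
   [phi x] is hypercyclic for [w y] exactly when [x <> y]; then [phi] reduces
   [~` Y] to [HCstar (w @` Y)].

   The vector [phi x] carries, in a sparse sequence of blocks, all finitely
   supported rational vectors [v m], scaled down by a power of 2 and multiplied by
   a bump function [c x m] which vanishes near a point [p] and is 1 away from it.
   The weight [w y] scales block [m] back up iff [c y m = 0], and otherwise
   postpones its 2s until after the block.  If [x <> y], some bump vanishes at [y]
   and is 1 at [x], for each target infinitely often, so the orbit of [phi x] is
   dense.  If [x = y], each block is either zero or never scaled back up, so that
   coordinate 0 of the orbit stays in [[-1, 1]]. *)
Require Import Defs.
From mathcomp Require Import all_boot all_order all_algebra.
From mathcomp Require Import all_classical all_reals all_analysis.
From mathcomp Require Import Rstruct Rstruct_topology.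
From mathcomp Require Import ring lra zify.
Import Order.TTheory GRing.Theory Num.Theory.
Import numFieldNormedType.Exports.
Local Open Scope classical_set_scope.
Local Open Scope ring_scope.
Set Implicit Arguments. Unset Strict Implicit. Unset Printing Implicit Defensive.

Implicit Types (x y z w : nat -> RR) (n i : nat).

(** * Square-summable sequences *)

Lemma sqsum_ge0 x : (0 <= sqsum x)%E.
Proof. by apply: nneseries_ge0 => i _ _; rewrite lee_fin sqr_ge0. Qed.

Lemma sqsum_leP x (c : RR) :
  (sqsum x <= c%:E)%E <-> forall n, \sum_(i < n) x i ^+ 2 <= c.
Proof.
have x2 i : (0 <= ((x i) ^+ 2)%:E)%E by rewrite lee_fin sqr_ge0.
split=> [xc n|xc].
  rewrite -lee_fin; apply: le_trans xc; rewrite -sumEFin.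
  by rewrite -(big_mkord xpredT (fun i => ((x i) ^+ 2)%:E)) nneseries_lim_ge.
apply: lime_le; first exact: is_cvg_nneseries.
by apply: nearW => n; rewrite big_mkord sumEFin lee_fin.
Qed.

Lemma square_summableP x :
  square_summable x <-> exists c, forall n, \sum_(i < n) x i ^+ 2 <= c.
Proof.
split=> [xfin|[c /sqsum_leP xc]]; last exact: le_lt_trans xc (ltry _).
have x0 := sqsum_ge0 x.
by exists (fine (sqsum x)); apply/sqsum_leP; rewrite fineK // ge0_fin_numE.
Qed.

Lemma l2norm_ge0 x : 0 <= l2norm x.
Proof. exact: sqrtr_ge0. Qed.

Lemma l2norm_le x (c : RR) :
  0 <= c -> (forall n, \sum_(i < n) x i ^+ 2 <= c ^+ 2) -> l2norm x <= c.
Proof.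
move=> c0 xc; rewrite /l2norm -[leRHS]ger0_norm // -sqrtr_sqr ler_sqrt ?sqr_ge0 //.
have x0 := sqsum_ge0 x.
move/sqsum_leP : xc => xc.
by rewrite -lee_fin fineK // ge0_fin_numE // (le_lt_trans xc) ?ltry.
Qed.

Lemma sum_le_l2norm x n :
  square_summable x -> \sum_(i < n) x i ^+ 2 <= l2norm x ^+ 2.
Proof.
move=> xfin.
have x0 := sqsum_ge0 x.
rewrite /l2norm sqr_sqrtr ?fine_ge0 //.
by move: n; apply/sqsum_leP; rewrite fineK // ge0_fin_numE.
Qed.

Lemma coord_le_l2norm x i : square_summable x -> `|x i| <= l2norm x.
Proof.
move=> xfin; rewrite -(ler_pXn2r (n := 2)) ?nnegrE ?l2norm_ge0 //.
rewrite real_normK ?num_real //; apply: le_trans (sum_le_l2norm i.+1 xfin).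
by rewrite big_ord_recr /= lerDr sumr_ge0 // => j _; rewrite sqr_ge0.
Qed.

(* With [t = b / a], sum the pointwise [(x + y)^2 <= (1 + t) x^2 + (1 + 1/t) y^2]. *)
Lemma sum_sqrD_le x y n (a b : RR) : 0 < a -> 0 < b ->
  \sum_(i < n) x i ^+ 2 <= a ^+ 2 -> \sum_(i < n) y i ^+ 2 <= b ^+ 2 ->
  \sum_(i < n) (x i + y i) ^+ 2 <= (a + b) ^+ 2.
Proof.
move=> a0 b0 xa yb.
apply: (@le_trans _ _ ((1 + b / a) * \sum_(i < n) x i ^+ 2
                       + (1 + a / b) * \sum_(i < n) y i ^+ 2)).
  rewrite !mulr_sumr -big_split /=; apply: ler_sum => i _.
  have : 0 <= (b * x i - a * y i) ^+ 2 / (a * b) by rewrite divr_ge0 ?sqr_ge0 // ltW ?mulr_gt0.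
  set X := x i; set Y := y i.
  suff -> : (b * X - a * Y) ^+ 2 / (a * b) =
     (1 + b / a) * X ^+ 2 + (1 + a / b) * Y ^+ 2 - (X + Y) ^+ 2 by rewrite subr_ge0.
  by field; rewrite !gt_eqF.
have -> : (a + b) ^+ 2 = (1 + b / a) * a ^+ 2 + (1 + a / b) * b ^+ 2.
  by field; rewrite !gt_eqF.
by apply: lerD; apply: ler_wpM2l => //; rewrite addr_ge0 // divr_ge0 // ltW.
Qed.

Lemma square_summableD x y : square_summable x -> square_summable y ->
  square_summable (fun i => x i + y i).
Proof.
move=> xfin yfin; apply/square_summableP.
exists ((l2norm x + 1 + (l2norm y + 1)) ^+ 2) => n.
have := l2norm_ge0 x; have := l2norm_ge0 y; move=> y0 x0.
apply: sum_sqrD_le; try by rewrite ltr_wpDl.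
- by apply: le_trans (sum_le_l2norm n xfin) _; rewrite ler_pXn2r ?nnegrE ?lerDl ?addr_ge0.
- by apply: le_trans (sum_le_l2norm n yfin) _; rewrite ler_pXn2r ?nnegrE ?lerDl ?addr_ge0.
Qed.

Lemma l2normD x y : square_summable x -> square_summable y ->
  l2norm (fun i => x i + y i) <= l2norm x + l2norm y.
Proof.
move=> xfin yfin; apply/ler_addgt0Pr => e e0.
have x0 := l2norm_ge0 x; have y0 := l2norm_ge0 y.
(* [sum_sqrD_le] asks for positive bounds, so each norm is enlarged by [e / 2]. *)
have le_sq (a : RR) : 0 <= a -> a ^+ 2 <= (a + e / 2) ^+ 2.
  by move=> a0; rewrite ler_pXn2r ?nnegrE ?lerDl ?addr_ge0 // divr_ge0 // ltW.
have -> : l2norm x + l2norm y + e = (l2norm x + e / 2) + (l2norm y + e / 2) by field.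
apply: l2norm_le => [|n]; first by rewrite !addr_ge0 // divr_ge0 // ltW.
apply: sum_sqrD_le; rewrite ?ltr_wpDl ?divr_gt0 //.
- exact: le_trans (sum_le_l2norm n xfin) (le_sq _ x0).
- exact: le_trans (sum_le_l2norm n yfin) (le_sq _ y0).
Qed.

Lemma square_summable_le (c : RR) x y :
  (forall i, x i ^+ 2 <= c * y i ^+ 2) -> 0 <= c ->
  square_summable y -> square_summable x.
Proof.
move=> xy c0 yfin; apply/square_summableP; exists (c * l2norm y ^+ 2) => n.
apply: (@le_trans _ _ (c * \sum_(i < n) y i ^+ 2)); last first.
  by rewrite ler_wpM2l // sum_le_l2norm.
by rewrite mulr_sumr ler_sum.
Qed.

Lemma square_summableB x y : square_summable x -> square_summable y ->
  square_summable (fun i => x i - y i).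
Proof.
move=> xfin yfin; apply: square_summableD => //.
by apply: (@square_summable_le 1 _ y) => // i; rewrite sqrrN mul1r.
Qed.

Lemma sum_geo_le x (c : RR) : (forall i, x i ^+ 2 <= c / 2 ^+ i) ->
  forall n, \sum_(i < n) x i ^+ 2 <= c * 2.
Proof.
move=> xc n.
have c0 : 0 <= c by have := xc 0%N; rewrite expr0 divr1; apply: le_trans; rewrite sqr_ge0.
(* The induction needs the exact partial sum [2 - 2 / 2 ^+ n] of the geometric series. *)
suff: \sum_(i < n) x i ^+ 2 <= c * (2 - 2 / 2 ^+ n).
  move/le_trans; apply; rewrite ler_wpM2l // gerBl divr_ge0 //.
elim: n => [|n IHn]; first by rewrite big_ord0 expr0 divr1 subrr mulr0.
rewrite big_ord_recr /=; apply: le_trans (lerD IHn (xc n)) _.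
suff -> : c * (2 - 2 / 2 ^+ n) + c / 2 ^+ n = c * (2 - 2 / 2 ^+ n.+1) by [].
by rewrite exprS; field; rewrite expf_neq0 // pnatr_eq0.
Qed.

Lemma finsupp_square_summable x n :
  (forall i, (n <= i)%N -> x i = 0) -> square_summable x.
Proof.
move=> x0; apply/square_summableP.
exists ((\sum_(j < n) x j ^+ 2 * 2 ^+ j) * 2); apply: sum_geo_le => i.
have t0 j : 0 <= x j ^+ 2 * 2 ^+ j by rewrite mulr_ge0 ?sqr_ge0 ?exprn_ge0.
have [ni|ni] := leqP n i.
  by rewrite x0 // expr0n divr_ge0 ?exprn_ge0 ?sumr_ge0.
rewrite ler_pdivlMr ?exprn_gt0 // (bigD1 (Ordinal ni)) //= lerDl.
exact: sumr_ge0.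
Qed.

(** The partial sums come within [e] of their supremum at some [N], and everything after [N] fits
    into what is left. *)
Lemma sum_sqr_tail x (e : RR) : square_summable x -> 0 < e ->
  exists N, forall n, \sum_(i < n) x (N + i)%N ^+ 2 <= e.
Proof.
move=> /square_summableP[c xc] e0.
pose E := range (fun n => \sum_(i < n) x i ^+ 2).
have Esup : has_sup E.
  by split; [exists (\sum_(i < 0) x i ^+ 2), 0%N|exists c => _ [n _ <-]].
have [_ [N _ <-] supN] := sup_adherent e0 Esup; exists N => n.
have : \sum_(i < N + n) x i ^+ 2 <= sup E.
  by apply: ub_le_sup; [case: Esup|exists (N + n)%N].
rewrite big_split_ord /=.
set s := \sum_(i < n) _; set t := \sum_(i < N) _.
by move: supN; rewrite -/t; lra.
Qed.

(** * Density of the finitely supported rational sequences *)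

Definition ratseq (s : seq rat) : nat -> RR := fun i => ratr (nth 0 s i).

Lemma square_summable_ratseq s : square_summable (ratseq s).
Proof.
apply: (@finsupp_square_summable _ (size s)) => i si.
by rewrite /ratseq nth_default // rmorph0.
Qed.

Lemma ratseq_dense x (e : RR) : square_summable x -> 0 < e ->
  exists s, l2norm (fun i => x i - ratseq s i) < e.
Proof.
(* The first [N] coordinates will cost at most [d * 2] and the tail at most [d], together
   [(e / 2) ^+ 2]. *)
move=> xfin e0; pose d := (e / 2) ^+ 2 / 3.
have d0 : 0 < d by rewrite !divr_gt0 // exprn_gt0 // divr_gt0.
have [N xN] := sum_sqr_tail xfin d0.
have approx i : exists q : rat, (x i - ratr q) ^+ 2 <= d / 2 ^+ i.
  have r0 : 0 < d / 2 ^+ i by rewrite divr_gt0 // exprn_gt0.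
  have s0 : 0 < Num.sqrt (d / 2 ^+ i) by rewrite sqrtr_gt0.
  have [|q] := @rat_in_itvoo RR (x i - Num.sqrt (d / 2 ^+ i)) (x i + Num.sqrt (d / 2 ^+ i)).
    by rewrite ltrD2l gtrN.
  rewrite in_itv /= => /andP[q1 q2]; exists q.
  rewrite -(sqr_sqrtr (ltW r0)) -[leLHS]real_normK ?num_real //.
  rewrite ler_pXn2r ?nnegrE ?sqrtr_ge0 // ler_norml.
  by apply/andP; split; lra.
have [q qP] := choice approx; exists (mkseq q N).
suff : l2norm (fun i => x i - ratseq (mkseq q N) i) <= e / 2 by lra.
apply: l2norm_le => [|n]; first lra.
apply: (@le_trans _ _ (\sum_(i < N + n) (x i - ratseq (mkseq q N) i) ^+ 2)).
  by rewrite addnC big_split_ord lerDl sumr_ge0 // => i _; rewrite sqr_ge0.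
have -> : (e / 2) ^+ 2 = d * 2 + d by rewrite /d; field.
rewrite big_split_ord /=; apply: lerD.
  (* Zeroed from [N] on, since [sum_geo_le] wants its bound at every index. *)
  pose y i := if (i < N)%N then x i - ratseq (mkseq q N) i else 0.
  rewrite (eq_bigr (fun i : 'I_N => y i ^+ 2)) => [|i _]; last by rewrite /y ltn_ord.
  apply: sum_geo_le => i; rewrite /y; case: ltnP => iN.
    by rewrite /ratseq nth_mkseq.
  by rewrite expr0n divr_ge0 ?exprn_ge0 // ltW.
under eq_bigr => i _ do rewrite /ratseq nth_default ?size_mkseq ?leq_addr // rmorph0 subr0.
exact: xN.
Qed.

(** * The space l2 is Polish *)

Definition l2dist (x y : l2) : RR := l2norm (fun i => l2val x i - l2val y i).

Lemma square_summable_l2B (x y : l2) :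
  square_summable (fun i => l2val x i - l2val y i).
Proof. exact: square_summableB (l2P x) (l2P y). Qed.

Lemma l2val_inj : injective l2val.
Proof.
move=> [x xP] [y yP] /= xy; move: yP; rewrite -xy => yP.
by congr L2; exact: Prop_irrelevance.
Qed.

Lemma l2dist_eq0 (x y : l2) : l2dist x y = 0 <-> x = y.
Proof.
split=> [xy0|->]; last first.
  apply/le_anti; rewrite l2norm_ge0 andbT.
  by apply: l2norm_le => // n; rewrite big1 ?expr0n // => i _; rewrite subrr expr0n.
apply/l2val_inj/funext => i; apply/eqP; rewrite -subr_eq0 -normr_le0 -xy0.
exact: (@coord_le_l2norm (fun i => l2val x i - l2val y i) i (square_summable_l2B x y)).
Qed.

Lemma l2distC (x y : l2) : l2dist x y = l2dist y x.
Proof.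
rewrite /l2dist /l2norm /sqsum; congr (Num.sqrt (fine _)).
by apply: eq_eseriesr => i _; rewrite -sqrrN opprB.
Qed.

Lemma l2dist_triangle (x y z : l2) : l2dist x z <= l2dist x y + l2dist y z.
Proof.
have := l2normD (square_summable_l2B x y) (square_summable_l2B y z).
congr (_ <= _); congr l2norm; apply/funext => i.
by rewrite addrA subrK.
Qed.

Lemma l2_openP (A : set l2) :
  open A <->
  (forall x : l2, A x -> exists2 e : RR, 0 < e & [set y | l2dist x y < e] `<=` A).
Proof.
have -> : open A = l2_open A by [].
split=> oA x Ax; have [e e0 eA] := oA x Ax; exists e => // y xy.
  by apply: eA; rewrite /= l2distC in xy.
by apply: eA; rewrite /= l2distC.
Qed.

Lemma cauchy_seq_cvg (R : realType) (f : nat -> R) :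
  (forall e, 0 < e -> exists N, forall n, (N <= n)%N -> `|f N - f n| < e) ->
  cvg (f @ \oo).
Proof.
move=> fC; apply: cauchy_cvg; apply: cauchy_exP => e e0; have [N fN] := fC e e0.
by exists (f N); exists N => // n /= /fN.
Qed.

Lemma sum_sqrB_lim_le (R : realType) (f : nat -> nat -> R) (a l : nat -> R) k N c :
  (forall i, f i @ \oo --> l i) ->
  (forall n, (N <= n)%N -> \sum_(i < k) (a i - f i n) ^+ 2 <= c) ->
  \sum_(i < k) (a i - l i) ^+ 2 <= c.
Proof.
move=> fl fc.
have cv : \sum_(i < k) (a i - f i n) ^+ 2 @[n --> \oo] --> \sum_(i < k) (a i - l i) ^+ 2.
  apply: cvg_big => [|i _]; first exact: add_continuous.
  under eq_fun do rewrite expr2.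
  by rewrite expr2; apply: cvgM; apply: cvgB; [exact: cvg_cst|exact: fl|exact: cvg_cst|exact: fl].
by apply: (cvgr_to_le cv); exists N.
Qed.

Lemma l2dist_complete (u : nat -> l2) :
  (forall e : RR, 0 < e -> exists N, forall m n,
    (N <= m)%N -> (N <= n)%N -> l2dist (u m) (u n) < e) ->
  exists l : l2, u @ \oo --> l.
Proof.
move=> uC.
have coordC i : cvg ((fun n => l2val (u n) i) @ \oo).
  apply: cauchy_seq_cvg => e e0; have [N uN] := uC e e0; exists N => n Nn.
  apply: le_lt_trans (uN N n (leqnn N) Nn).
  exact: (@coord_le_l2norm (fun i => l2val (u N) i - l2val (u n) i) i (square_summable_l2B _ _)).
pose l i := lim ((fun n => l2val (u n) i) @ \oo).
(* With [k] fixed, only a finite sum passes to the coordinatewise limit; the bound does not depend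
   on [k]. *)
have ul (e : RR) (N : nat) : (forall m n,
    (N <= m)%N -> (N <= n)%N -> l2dist (u m) (u n) < e) ->
    forall m k, (N <= m)%N -> \sum_(i < k) (l2val (u m) i - l i) ^+ 2 <= e ^+ 2.
  move=> uN m k Nm.
  apply: (@sum_sqrB_lim_le _ (fun i n => l2val (u n) i)) => [i|n Nn]; first exact: coordC.
  apply: le_trans (sum_le_l2norm k (square_summable_l2B (u m) (u n))) _.
  have /ltW le_e := uN m n Nm Nn.
  by rewrite ler_pXn2r ?nnegrE ?l2norm_ge0 ?(le_trans (l2norm_ge0 _) le_e).
have lP : square_summable l.
  have [N uN] := uC 1 ltr01.
  have : square_summable (fun i => l2val (u N) i - l i).
    by apply/square_summableP; exists (1 ^+ 2) => n; exact: ul uN _ _ _.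
  move=> /(square_summableB (l2P (u N))); congr square_summable.
  by apply/funext => i; rewrite subKr.
exists (L2 lP) => A; rewrite nbhsE => -[U [/l2_openP oU Ol] UA].
have [e e0 eU] := oU _ Ol; have e20 : 0 < e / 2 by rewrite divr_gt0.
have [N uN] := uC _ e20; exists N => // n /= Nn; apply: UA; apply: eU => /=.
rewrite l2distC; apply: (@le_lt_trans _ _ (e / 2)); last by lra.
by apply: l2norm_le => [|k]; [exact: ltW|exact: ul uN _ _ _].
Qed.

Lemma polish_l2 : polish l2.
Proof.
split; last first.
  exists l2dist; split.
  - by split; [move=> x y; exact: l2norm_ge0|exact: l2dist_eq0].
  - exact: l2distC.
  - exact: l2dist_triangle.
  - exact: l2_openP.
  - exact: l2dist_complete.
exists (range (fun s => L2 (square_summable_ratseq s))); split.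
  exact: card_le_trans (card_image_le _ _) (countableP _).
apply/seteqP; split=> // x _ A; rewrite nbhsE => -[U [/l2_openP oU Ox] UA].
have [e e0 eU] := oU _ Ox; have [s xs] := ratseq_dense (l2P x) e0.
by exists (L2 (square_summable_ratseq s)); split; [exists s|exact/UA/eU].
Qed.

(** * Orbits of block-encoded vectors *)

(** Weights of at most 2 multiply sums of squares by at most 4, so the fallback branch of [B] is
    never taken. *)
Lemma l2val_B w (x : l2) : one_two w -> l2val (B w x) = bshift w (l2val x).
Proof.
move=> w12; rewrite /B; case: pselect => // -[]; apply/square_summableP.
exists (4 * l2norm (l2val x) ^+ 2) => n.
apply: (@le_trans _ _ (4 * \sum_(i < n.+1) l2val x i ^+ 2)); last first.
  by rewrite ler_wpM2l ?sum_le_l2norm //; exact: l2P.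
rewrite big_ord_recl mulrDr mulr_sumr; apply: ler_wpDl.
  by rewrite mulr_ge0 ?sqr_ge0.
apply: ler_sum => i _; rewrite /bshift exprMn; apply: ler_wpM2r; first exact: sqr_ge0.
by case: (w12 i) => ->; lra.
Qed.

Lemma l2val_iterB w (x : l2) k i : one_two w ->
  l2val (iter k (B w) x) i = (\prod_(j < k) w (i + j)%N) * l2val x (i + k)%N.
Proof.
move=> w12; elim: k i => [|k IHk] i; first by rewrite big_ord0 mul1r addn0.
rewrite iterS l2val_B // /bshift IHk big_ord_recl addn0 mulrA addSnnS.
by congr (_ * _ * _); apply: eq_bigr => j _; rewrite lift0 addSnnS.
Qed.

(** The divisor [2 ^+ k] pays for the amplification [2 ^+ n], for the size [2 ^+ b] of an entry and
    for a geometric decay in [q]. Both decay estimates on [tape] are instances. *)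
Lemma scaled_sqr_le (d r : RR) n b k q : 0 <= d -> `|r| <= d * 2 ^+ b ->
  (2 * n + 2 * b + q <= 2 * k)%N -> (2 ^+ n * (r / 2 ^+ k)) ^+ 2 <= d ^+ 2 / 2 ^+ q.
Proof.
move=> d0 rd le_k.
have r2 : r ^+ 2 <= d ^+ 2 * 2 ^+ (b * 2).
  by rewrite exprM -exprMn -real_normK ?num_real // ler_pXn2r ?nnegrE ?mulr_ge0 ?exprn_ge0.
have -> : (2 ^+ n * (r / 2 ^+ k)) ^+ 2 = 2 ^+ (n * 2) * r ^+ 2 / 2 ^+ (k * 2).
  by rewrite !exprMn exprVn -!exprM mulrA.
rewrite ler_pdivrMr ?exprn_gt0 // mulrAC ler_pdivlMr ?exprn_gt0 //.
apply: (@le_trans _ _ (2 ^+ (n * 2) * (d ^+ 2 * 2 ^+ (b * 2)) * 2 ^+ q)).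
  by rewrite ler_wpM2r ?exprn_ge0 // ler_wpM2l ?exprn_ge0.
rewrite mulrCA -mulrA ler_wpM2l ?sqr_ge0 // -!exprD ler_eXn2l ?ltr1n //; lia.
Qed.

Section Tape.
(* The half-line is cut into consecutive blocks: block [m] starts at [bstart m]
   and consists of a gap of length [gap m], a data part of length
   [size (v m)], and a second gap of length [gap m].  On a block with [a m] the
   weights are 2 on the first gap, otherwise on the second one; all other weights
   are 1.  Hence the number [gaps m] of weights 2 before block [m] does not
   depend on [a], while the number of weights 2 before the data of block [m] is
   [gaps m + gap m] or [gaps m] according to [a m]. *)
Variables (v : nat -> seq rat) (b : nat -> nat).
Implicit Types (a : pred nat) (c : nat -> RR).

(* The gap of block [m] when the block starts at [N]; it is long enough for the
   later data to be negligible after [bstart m + gap m] shifts. *)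
Definition gap_after (m N : nat) : nat := 3 * N + 2 * b m + size (v m) + m + 1.

Fixpoint bstart (m : nat) : nat :=
  if m is m'.+1 then
    (bstart m' + (gap_after m' (bstart m')).*2 + size (v m'))%N
  else 0%N.

Definition gap m := gap_after m (bstart m).

Lemma bstartS m : bstart m.+1 = (bstart m + (gap m).*2 + size (v m))%N.
Proof. by []. Qed.

Lemma bstart_ltS m : (bstart m < bstart m.+1)%N.
Proof. rewrite bstartS /gap /gap_after; lia. Qed.

Lemma leq_bstart m m' : (m <= m')%N -> (bstart m <= bstart m')%N.
Proof.
move/subnK <-; elim: (m' - m)%N => // k IHk.
by rewrite addSn (leq_trans IHk) // ltnW // bstart_ltS.
Qed.

Lemma bstart_ge m : (m <= bstart m)%N.
Proof. by elim: m => // m IHm; exact: leq_ltn_trans IHm (bstart_ltS m). Qed.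

Lemma ex_blk q : exists m, (q < bstart m.+1)%N.
Proof. by exists q; exact: bstart_ge. Qed.

Definition blk q := ex_minn (ex_blk q).
Definition off q := (q - bstart (blk q))%N.

Lemma blk_uniq m q : (bstart m <= q < bstart m.+1)%N -> blk q = m.
Proof.
move=> /andP[mq qm]; rewrite /blk; case: ex_minnP => m' qm' m'_min.
apply/eqP; rewrite eqn_leq m'_min //= leqNgt; apply/negP => lt_m'm.
by have := leq_bstart lt_m'm; rewrite leqNgt (leq_ltn_trans mq qm').
Qed.

Lemma blkP q : (bstart (blk q) <= q < bstart (blk q).+1)%N.
Proof.
rewrite /blk; case: ex_minnP => -[|m] qm m_min; first by rewrite qm.
by rewrite qm andbT leqNgt; apply/negP => /m_min; rewrite ltnn.
Qed.

Lemma blkD m o : (o < (gap m).*2 + size (v m))%N -> blk (bstart m + o) = m.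
Proof. by move=> lto; apply: blk_uniq; rewrite bstartS; lia. Qed.

Lemma offD m o : (o < (gap m).*2 + size (v m))%N -> off (bstart m + o) = o.
Proof. by move=> lto; rewrite /off blkD // addKn. Qed.

(** * Weights, and the vectors encoded for them *)

Definition is_two (a : pred nat) q : bool :=
  if a (blk q) then (off q < gap (blk q))%N
  else (gap (blk q) + size (v (blk q)) <= off q)%N.

Definition weight (a : pred nat) q : RR := 2 ^+ is_two a q.

Definition twos (a : pred nat) q : nat := \sum_(j < q) is_two a j.

Lemma weight_one_two a : one_two (weight a).
Proof. by move=> q; rewrite /weight; case: is_two; [right|left]. Qed.

Lemma twosS a q : twos a q.+1 = (twos a q + is_two a q)%N.
Proof. by rewrite /twos big_ord_recr. Qed.

Lemma twosD_le a q n : (twos a (q + n) <= twos a q + n)%N.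
Proof.
elim: n => [|n IHn]; first by rewrite !addn0.
by rewrite addnS twosS; case: is_two; lia.
Qed.

(** A telescoping quotient in multiplied form, which avoids subtracting exponents; [orbit_weight]
    inherits this form. *)
Lemma prod_weight a q n :
  2 ^+ twos a q * \prod_(j < n) weight a (q + j)%N = 2 ^+ twos a (q + n).
Proof.
elim: n => [|n IHn]; first by rewrite big_ord0 mulr1 addn0.
by rewrite big_ord_recr mulrA IHn addnS twosS exprD.
Qed.

Lemma twos_blk a m o : (o <= (gap m).*2 + size (v m))%N ->
  twos a (bstart m + o) =
  (twos a (bstart m) + if a m then minn o (gap m) else o - (gap m + size (v m)))%N.
Proof.
elim: o => [|o IHo] o_le; first by rewrite addn0 min0n sub0n if_same addn0.
rewrite addnS twosS IHo 1?ltnW // /is_two blkD // offD //.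
case: (a m); lia.
Qed.

Definition gaps m : nat := \sum_(j < m) gap j.

Lemma twos_bstart a m : twos a (bstart m) = gaps m.
Proof.
elim: m => [|m IHm]; first by rewrite /twos /gaps !big_ord0.
rewrite bstartS -addnA twos_blk // IHm /gaps big_ord_recr /=.
by case: (a m); lia.
Qed.

Lemma twos_data a m i : (i < size (v m))%N ->
  twos a (bstart m + gap m + i) = (gaps m + a m * gap m)%N.
Proof.
move=> i_lt; rewrite -addnA twos_blk ?twos_bstart; last by lia.
by case: (a m); lia.
Qed.

(** If [a m] holds, the divisor is the product of all weights before the data, so it is undone
    exactly when an entry reaches coordinate 0. Otherwise a factor [1 / 2 ^+ gap m] survives. *)
Definition tape (c : nat -> RR) q : RR :=
  if (gap (blk q) <= off q < gap (blk q) + size (v (blk q)))%N then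
    c (blk q) * ratseq (v (blk q)) (off q - gap (blk q)) / 2 ^+ (gaps (blk q) + gap (blk q))
  else 0.

Lemma tapeB c c' q : tape c q - tape c' q = tape (fun m => c m - c' m) q.
Proof. by rewrite /tape; case: ifP => _; rewrite ?subr0 // !mulrBl. Qed.

Lemma tape_data c m i : (i < size (v m))%N ->
  tape c (bstart m + gap m + i) = c m * ratseq (v m) i / 2 ^+ (gaps m + gap m).
Proof.
move=> i_lt; have lto : (gap m + i < (gap m).*2 + size (v m))%N by lia.
by rewrite /tape -addnA blkD // offD // leq_addr ltn_add2l i_lt addKn.
Qed.

Lemma tape_gap c m i : (size (v m) <= i)%N -> (bstart m + gap m + i < bstart m.+1)%N ->
  tape c (bstart m + gap m + i) = 0.
Proof.
rewrite bstartS => i_ge i_lt.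
have lto : (gap m + i < (gap m).*2 + size (v m))%N by lia.
by rewrite /tape -addnA blkD // offD // [in X in _ && X]ltn_add2l ltnNge i_ge andbF.
Qed.

Lemma tape_cases c q :
  tape c q = 0 \/ exists m i, [/\ blk q = m, (i < size (v m))%N & q = (bstart m + gap m + i)%N].
Proof.
rewrite /tape; case: ifP => [/andP[geo lto]|_]; [right|by left].
have /andP[q_ge _] := blkP q.
exists (blk q), (off q - gap (blk q))%N; split=> //; rewrite /off in geo lto *; lia.
Qed.

(** The scale [d] has two uses: [d = 1] gives summability, and [d] the distance of two points gives,
    through [tapeB], a Lipschitz bound for the encoding. *)
Lemma tape_le (d : RR) c q : 0 <= d ->
  (forall m i, `|c m| * `|ratseq (v m) i| <= d * 2 ^+ b m) ->
  tape c q ^+ 2 <= d ^+ 2 / 2 ^+ q.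
Proof.
move=> d0 cv; have [->|[m [i [qm i_lt ->]]]] := tape_cases c q.
  by rewrite expr0n divr_ge0 ?exprn_ge0.
rewrite tape_data // -[X in X ^+ 2]mul1r -(expr0 2).
apply: (scaled_sqr_le (b := b m)) => //; first by rewrite normrM cv.
rewrite /gap /gap_after; lia.
Qed.

Lemma square_summable_tape c : (forall m i, `|c m| * `|ratseq (v m) i| <= 2 ^+ b m) ->
  square_summable (tape c).
Proof.
move=> cv; apply/square_summableP; exists (1 ^+ 2 * 2); apply: sum_geo_le => q.
by apply: tape_le => // m i; rewrite mul1r.
Qed.

Lemma tape_late c m q : (forall m i, `|c m| * `|ratseq (v m) i| <= 2 ^+ b m) ->
  (bstart m.+1 <= q)%N ->
  (2 ^+ (bstart m + gap m) * tape c q) ^+ 2 <= (2 ^+ m)^-1 / 2 ^+ q.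
Proof.
move=> cv q_ge; have [->|[m' [i [qm' i_lt q_eq]]]] := tape_cases c q.
  by rewrite mulr0 expr0n divr_ge0 ?exprn_ge0 ?invr_ge0 ?exprn_ge0.
have m'_gt : (m < m')%N.
  rewrite ltnNge; apply/negP => /(@leq_ltn_trans _ _ m.+1)/(_ (ltnSn m)) le_m'm.
  have := leq_bstart le_m'm; have /andP[_] := blkP q; rewrite qm'; lia.
have n_le : (bstart m + gap m <= bstart m')%N.
  by apply: leq_trans (leq_bstart m'_gt); rewrite bstartS; lia.
rewrite q_eq tape_data // -invfM -exprD -[leRHS]div1r.
have := @scaled_sqr_le 1 (c m' * ratseq (v m') i) (bstart m + gap m) (b m') (gaps m' + gap m')
  (m + (bstart m' + gap m' + i)) ler01.
rewrite normrM mul1r expr1n; apply=> //.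
(* Since [n <= bstart m'], [m < m'] and [i < size (v m')], the length [gap m'] covers
   [2 * n + bstart m'], [2 * b m'], [m] and [i]; this is why [gap_after] contains [3 * N]. *)
move: (bstart m + gap m)%N n_le => n n_le; rewrite /gap /gap_after; lia.
Qed.

(** * Orbits of encoded vectors *)

Lemma orbit_weight a (x : l2) n i :
  2 ^+ twos a i * l2val (iter n (B (weight a)) x) i = 2 ^+ twos a (i + n) * l2val x (i + n)%N.
Proof. by rewrite l2val_iterB ?prod_weight ?mulrA ?prod_weight //; exact: weight_one_two. Qed.

(** As [i] grows, the shifted vector shows the data of block [m], then the zeros of its second gap,
    then later blocks, which are negligible by [tape_late]. *)
Lemma orbit_approx a c m (x : l2) : l2val x = tape c ->
  (forall m i, `|c m| * `|ratseq (v m) i| <= 2 ^+ b m) -> a m -> c m = 1 ->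
  forall i, (l2val (iter (bstart m + gap m) (B (weight a)) x) i
             - ratseq (v m) i / 2 ^+ twos a i) ^+ 2 <= (2 ^+ m)^-1 / 2 ^+ i.
Proof.
move=> xc cv am cm1 i; have := orbit_weight a x (bstart m + gap m) i.
set y := l2val _ i; rewrite xc addnC => y_eq.
have t0 : (2 : RR) ^+ twos a i != 0 by rewrite expf_neq0.
have rhs0 : 0 <= (2 ^+ m)^-1 / 2 ^+ i :> RR by rewrite divr_ge0 ?invr_ge0 ?exprn_ge0.
have [i_lt|i_ge] := ltnP i (size (v m)).
  have -> : y = ratseq (v m) i / 2 ^+ twos a i; last by rewrite subrr expr0n.
  apply: (mulfI t0); rewrite y_eq tape_data // twos_data // am mul1n cm1 mul1r.
  by rewrite mulrCA divff ?mulr1 ?expf_neq0 // mulrCA divff ?mulr1.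
rewrite {1}/ratseq nth_default // rmorph0 mul0r subr0.
have [lt_next|ge_next] := ltnP (bstart m + gap m + i) (bstart m.+1).
  suff -> : y = 0 by rewrite expr0n.
  by apply: (mulfI t0); rewrite y_eq tape_gap // !mulr0.
have := tape_late cv ge_next; set r := tape _ _ in y_eq *; set n := (_ + gap m)%N in y_eq *.
move=> rn; apply: (@le_trans _ _ ((2 ^+ n * r) ^+ 2)); last first.
  apply: (le_trans rn); rewrite ler_wpM2l ?invr_ge0 ?exprn_ge0 //.
  by rewrite lef_pV2 ?posrE ?exprn_gt0 // ler_eXn2l ?ltr1n ?leq_addl.
(* At most [n] of the [n] weights applied are 2, so [r] is scaled by at most [2 ^+ n]. *)
have t20 : 0 < (2 ^+ twos a i) ^+ 2 :> RR by rewrite !exprn_gt0.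
rewrite -(ler_pM2l t20) -!exprMn y_eq mulrA -exprD !exprMn ler_wpM2r ?sqr_ge0 //.
by rewrite -!exprM ler_eXn2l ?ltr1n // leq_mul2r addnC twosD_le.
Qed.

(** Data of a block with [a m] vanish. For the other blocks the 2s come after the data, and the
    remaining divisor [2 ^+ gap m] beats [2 ^+ b m]. *)
Lemma orbit_coord0_le1 a c (x : l2) k : l2val x = tape c ->
  (forall m i, `|c m| * `|ratseq (v m) i| <= 2 ^+ b m) ->
  (forall m, a m -> c m = 0) ->
  `|l2val (iter k (B (weight a)) x) 0%N| <= 1.
Proof.
move=> xc cv ac; have := orbit_weight a x k 0.
rewrite {1}/twos big_ord0 expr0 mul1r add0n xc => ->.
have [->|[m [i [_ i_lt ->]]]] := tape_cases c k; first by rewrite mulr0 normr0.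
rewrite tape_data // twos_data //; have [am|_] := boolP (a m).
  by rewrite ac // !mul0r mulr0 normr0.
rewrite mul0n addn0 normrM normrM normrM normfV !normrX normr_nat.
rewrite mulrA ler_pdivrMr ?exprn_gt0 // mul1r exprD ler_wpM2l ?exprn_ge0 //.
apply: (le_trans (cv m i)); rewrite ler_eXn2l ?ltr1n //.
rewrite /gap /gap_after; lia.
Qed.

Lemma HC_weight a c (x : l2) : l2val x = tape c ->
  (forall m i, `|c m| * `|ratseq (v m) i| <= 2 ^+ b m) ->
  (forall s n, exists m, [/\ (n <= m)%N, v m = s, a m & c m = 1]) ->
  HC (weight a) x.
Proof.
move=> xc cv hits A [y0 Ay0] /l2_openP oA.
have [e e0 eA] := oA _ Ay0.
have e20 : 0 < e / 2 by rewrite divr_gt0.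
have [s s_near] := ratseq_dense (l2P y0) e20.
(* Chosen so that [n <= m] makes the error bound [2 / 2 ^+ m] at most [(e / 4) ^+ 2]. *)
pose n := Num.bound (2 / (e / 4) ^+ 2).
(* After the shifts, coordinate [i] of the data of block [m] is divided by
   [2 ^+ twos a i], whence the compensating factor in the target. *)
have [m [n_le vm am cm1]] := hits (mkseq (fun i => nth 0 s i * 2 ^+ twos a i) (size s)) n.
set k := (bstart m + gap m)%N.
exists (iter k (B (weight a)) x); split; last by exists k.
apply: eA => /=; apply: le_lt_trans (l2dist_triangle _ (L2 (square_summable_ratseq s)) _) _.
suff : l2dist (iter k (B (weight a)) x) (L2 (square_summable_ratseq s)) <= e / 4.
  by rewrite l2distC; move: s_near; rewrite /l2dist /=; lra.
have e40 : 0 < e / 4 by rewrite divr_gt0.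
apply: l2norm_le => [|j]; first exact: ltW.
apply: (@le_trans _ _ ((2 ^+ m)^-1 * 2)).
  apply: (@sum_geo_le (fun i => l2val (iter k (B (weight a)) x) i - ratseq s i)) => i.
  have := orbit_approx xc cv am cm1 i.
  rewrite vm /ratseq /=; suff <- : ratr (nth 0 s i) = ratr
     (nth 0 (mkseq (fun i => nth 0 s i * 2 ^+ twos a i) (size s)) i) / 2 ^+ twos a i :> RR by [].
  have [i_lt|i_ge] := ltnP i (size s); last first.
    by rewrite !nth_default ?size_mkseq // rmorph0 mul0r.
  by rewrite nth_mkseq // rmorphM rmorphXn /= ratr_nat mulfK // expf_neq0.
rewrite mulrC ler_pdivrMr ?exprn_gt0 // mulrC -ler_pdivrMr ?exprn_gt0 //.
apply: (@le_trans _ _ n%:R).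
  by apply/ltW/archi_boundP; rewrite divr_ge0 ?exprn_ge0 // ltW.
by rewrite -natrX ler_nat (leq_trans n_le) // ltnW // ltn_expl.
Qed.

(** The orbit misses the nonempty open set of vectors whose coordinate 0 exceeds 1. *)
Lemma not_HC_weight a c (x : l2) : l2val x = tape c ->
  (forall m i, `|c m| * `|ratseq (v m) i| <= 2 ^+ b m) ->
  (forall m, a m -> c m = 0) ->
  ~ HC (weight a) x.
Proof.
move=> xc cv ac xHC.
have [|| y [/= gt1 [k _ kE]]] := xHC [set y : l2 | 1 < l2val y 0%N]; last first.
- by move: gt1; rewrite -kE ltNge (le_trans (ler_norm _)) // (orbit_coord0_le1 k xc cv ac).
- apply/l2_openP => y /= y1; exists (l2val y 0%N - 1); first by rewrite subr_gt0.
  move=> z /= yz; have := coord_le_l2norm 0 (square_summable_l2B y z).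
  by move=> /(le_lt_trans)/(_ yz)/(le_lt_trans (ler_norm _)); lra.
- have fin2 : square_summable (ratseq [:: 2]) by exact: square_summable_ratseq.
  by exists (L2 fin2); rewrite /= /ratseq /= ratr_nat ltr1n.
Qed.
End Tape.

(** * Separating points by hypercyclicity *)

Definition clamp (t : RR) : RR := Num.min 1 (Num.max 0 t).

Lemma clamp_bounds t : 0 <= clamp t <= 1.
Proof. by rewrite /clamp le_min ge_min lexx /= ler01 le_max lexx. Qed.

Lemma clamp_le0 t : t <= 0 -> clamp t = 0.
Proof. by move=> t0; rewrite /clamp (max_idPl t0) (min_idPr ler01). Qed.

Lemma clamp_ge1 t : 1 <= t -> clamp t = 1.
Proof.
by move=> t1; apply/min_idPl; rewrite le_max t1 orbT.
Qed.

Lemma clamp_lipschitz (s t : RR) : `|clamp s - clamp t| <= `|s - t|.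
Proof.
wlog le_st : s t / s <= t.
  move=> H; have [/H//|/ltW/H] := leP s t.
  by rewrite distrC (distrC t).
rewrite distrC (distrC s) [leRHS]ger0_norm ?subr_ge0 //.
rewrite /clamp /Num.min /Num.max.
case: (ltP 0 s) => ?; case: (ltP 0 t) => ?; rewrite ?ltr10;
  case: (ltP 1 s) => ?; case: (ltP 1 t) => ?; rewrite ler_norml; apply/andP; split; lra.
Qed.

(** The sequence inverts an injection of [D] into [nat]; indices outside its image get the default
    [x0]. *)
Lemma seq_dense (X : topologicalType) (x0 : X) (D : set X) :
  countable D -> closure D = setT ->
  exists p : nat -> X, forall A, open A -> A !=set0 -> exists n, A (p n).
Proof.
move=> /countable_injP[f f_inj] clD.
have /choice[p pP] n : exists a, forall a', D a' -> f a' = n -> a = a'.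
  have [[a [Da fa]]|noa] := pselect (exists a, D a /\ f a = n).
    by exists a => a' Da' fa'; apply: f_inj; rewrite ?inE // fa fa'.
  by exists x0 => a' Da' fa'; case: noa; exists a'.
exists p => A oA [x Ax].
have : closure D x by rewrite clD.
by move=> /(_ A (open_nbhs_nbhs (conj oA Ax)))[a [Da Aa]]; exists (f a); rewrite (pP _ a Da).
Qed.

Lemma ex_log_bound (s : seq rat) (r : RR) : 0 <= r ->
  exists n, forall i, r * `|ratseq s i| <= 2 ^+ n.
Proof.
move=> r0; pose t := \sum_(i < size s) r * `|ratseq s i|.
have t0 i : 0 <= r * `|ratseq s i| by rewrite mulr_ge0.
exists (Num.bound t) => i; apply: (@le_trans _ _ t).
  have [i_lt|i_ge] := ltnP i (size s); last first.
    by rewrite {1}/ratseq nth_default // rmorph0 normr0 mulr0 sumr_ge0.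
  by rewrite /t (bigD1 (Ordinal i_lt)) //= lerDl sumr_ge0.
apply: le_trans (ltW (archi_boundP _)) _; first exact: sumr_ge0.
by rewrite -natrX ler_nat ltnW // ltn_expl.
Qed.

Lemma HC_separation (X : topologicalType) : polish X -> (exists x0 : X, True) ->
  exists (phi : X -> l2) (w : X -> nat -> RR),
    [/\ continuous phi, forall y : X, one_two (w y) & forall x y : X, HC (w y) (phi x) <-> x <> y].
Proof.
move=> [[D [cD clD]] [d [[d0 d_eq0] dC dT d_open _]]] [x0 _].
have [p p_dense] := seq_dense x0 cD clD.
have p_near (y : X) (e : RR) : 0 < e -> exists n, d y (p n) < e.
  move=> e0; apply: (p_dense [set z : X | d y z < e]).
    apply/d_open => z /= yz; exists (e - d y z); first by rewrite subr_gt0.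
    by move=> z' /= zz'; apply: le_lt_trans (dT y z z') _; rewrite -ltrBrDl.
  by exists y; rewrite /= (d_eq0 y y).2.
(* [m] codes a target [s], a point [p j], a scale [1 / (K + 1)], and an arbitrary
   extra exponent of 3, so that every triple has arbitrarily large codes. *)
pose code m : seq rat * nat * nat := odflt ([::], 0, 0)%N (unpickle (logn 2 m)).
pose v m := (code m).1.1; pose k m := (code m).2.
have code_inf t n : exists2 m, (n <= m)%N & code m = t.
  exists (2 ^ pickle t * 3 ^ n)%N; last first.
    rewrite /code lognM ?expn_gt0 // pfactorK // (@logn_coprime _ (3 ^ n)) ?addn0 ?pickleK //.
    by rewrite coprimeXr.
  by apply: leq_trans (ltnW (ltn_expl n (isT : 1 < 3)%N)) _; rewrite leq_pmull ?expn_gt0.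
(* Besides the size of the target, [b m] absorbs the Lipschitz constant [(k m).+1] of the bump
   below. *)
have /choice[b bP] m : exists n, forall i, (k m).+1%:R * `|ratseq (v m) i| <= 2 ^+ n.
  exact: ex_log_bound.
(* The bump is 0 up to distance [1 / (k m).+1] from the coded point and 1 from twice that distance
   on. *)
pose c (x : X) m := clamp ((k m).+1%:R * d x (p (code m).1.2) - 1).
have c_lip (x y : X) m i : `|c x m - c y m| * `|ratseq (v m) i| <= d x y * 2 ^+ b m.
  apply: (@le_trans _ _ (d x y * ((k m).+1%:R * `|ratseq (v m) i|))); last first.
    by rewrite ler_wpM2l.
  rewrite mulrA ler_wpM2r //; apply: le_trans (clamp_lipschitz _ _) _.
  rewrite opprB addrA addrNK -mulrBr normrM ger0_norm // mulrC ler_wpM2r //.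
  set q := p _; rewrite ler_norml; apply/andP; split.
    by have := dT y x q; rewrite (dC y x); lra.
  by have := dT x y q; lra.
have c_le (x : X) m i : `|c x m| * `|ratseq (v m) i| <= 2 ^+ b m.
  apply: le_trans (bP m i); rewrite ler_wpM2r //.
  have /andP[c0 c1] := clamp_bounds ((k m).+1%:R * d x (p (code m).1.2) - 1).
  by rewrite ger0_norm // (le_trans c1) // ler1n.
pose phi (x : X) := L2 (square_summable_tape (c_le x)).
exists phi, (fun y : X => weight v b (fun m => c y m == 0)); split.
- apply/continuousP => A /l2_openP oA; apply/d_open => x Ax.
  have [e e0 eA] := oA _ Ax; exists (e / 2); first by rewrite divr_gt0.
  (* The geometric sum bounds the squared distance by [d x y ^+ 2 * 2]; the constant 2 is a
     convenient bound for its square root. *)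
  move=> y /= xy; apply: eA => /=; apply: (@le_lt_trans _ _ (2 * d x y)); last lra.
  apply: l2norm_le => [|n]; first by rewrite mulr_ge0.
  apply: (@le_trans _ _ (d x y ^+ 2 * 2)).
    apply: (@sum_geo_le (fun q => tape v b (c x) q - tape v b (c y) q)) => q.
    by rewrite tapeB; apply: tape_le.
  rewrite exprMn mulrC ler_wpM2r ?sqr_ge0 //; lra.
- by move=> y; exact: weight_one_two.
move=> x y; split=> [xHC xy|xy].
  by move: xHC; apply: (@not_HC_weight _ _ _ (c x)) => // m /eqP; rewrite xy.
apply: (@HC_weight _ _ _ (c x)) => // s n.
have dxy : 0 < d x y by rewrite lt_neqAle d0 andbT; apply/eqP => /esym/d_eq0.
(* If [p j] is within [1 / K.+1] of [y], the 3 leaves [x] at distance more than [2 / K.+1] from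
   [p j], where the bump is 1. *)
pose K := Num.bound (3 / d x y).
have Kd : 3 <= K.+1%:R * d x y.
  rewrite -ler_pdivrMr //; apply: le_trans (ltW (archi_boundP _)) _.
    by rewrite divr_ge0 // ltW.
  by rewrite ler_nat leqnSn.
have K0 : 0 < K.+1%:R :> RR by rewrite ltr0n.
have [j yj] : exists j, d y (p j) < K.+1%:R^-1 by apply: p_near; rewrite invr_gt0.
have Kyj : K.+1%:R * d y (p j) < 1 by rewrite mulrC -ltr_pdivlMr // div1r.
have [m n_le m_code] := code_inf (s, j, K) n; exists m; split=> //.
- by rewrite /v m_code.
- by apply/eqP/clamp_le0; rewrite /k m_code /=; lra.
- apply: clamp_ge1; rewrite /k m_code /=.
  have : K.+1%:R * d x y <= K.+1%:R * d x (p j) + K.+1%:R * d y (p j).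
    by rewrite -mulrDr ler_pM2l // (dC y) dT.
  lra.
Qed.

Theorem theorem1 (Gamma : forall T : topologicalType, set (set T)) :
  pointclass Gamma -> non_self_dual Gamma -> contains_closed Gamma ->
  exists W : set (nat -> RR), W `<=` one_two /\ ~ Gamma l2 (HCstar W).
Proof.
move=> [preimG _ _] [X [Y [polX [GY nGY]]]] _.
(* In an empty space [Y] equals its complement, against the choice of [Y]; otherwise a point is
   available for [HC_separation]. *)
have [X0|noX] := pselect (exists x0 : X, True); last first.
  case: nGY; rewrite /dual_pointclass /=; suff <- : Y = ~` Y by [].
  by apply/seteqP; split=> x; case: noX; exists x.
have [phi [w [phi_cont w12 phiHC]]] := HC_separation polX X0.
exists (w @` Y); split=> [_ [y _ <-]|GW]; first exact: w12.
apply: nGY; rewrite /dual_pointclass /=.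
suff <- : phi @^-1` HCstar (w @` Y) = ~` Y by exact: preimG polish_l2 _ _ _.
apply/seteqP; split=> [x xHC Yx|x nYx _ [y Yy <-]].
  by have /phiHC := xHC (w x) (imageP w Yx).
by apply/phiHC => xy; apply: nYx; rewrite xy.
Qed.
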